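(* Let $G$ be an upward planar graph of width $w$. Then $\operatorname{pn}(G) \leq 14w$.
   Context: All graphs are finite and directed. A directed acyclic graph $G$ is upward planar if it has a drawing in the Euclidean plane in which vertices are points, every edge $(u,v)$ is a strictly $y$-monotone curve with lower endpoint $u$ and upper endpoint $v$, and every edge is disjoint from other points and curves except in its endpoints. For vertices $u,v$ of a directed acyclic graph $G$, write $u \prec_G v$ if $u\neq v$ and there is a directed path from $u$ to $v$, and $u\preceq_G v$ if $u \prec_G v$ or $u=v$. Vertices $u,v$ are comparable if $u\preceq_G v$ or $v\preceq_G u$, and incomparable otherwise. The width of $G$ is the largest number of pairwise incomparable vertices in $G$. Given a topological ordering $<$ of $G$ (a linear ordering of the vertices with $u<v$ for every edge $(u,v)$), two edges $(u_1,v_1),(u_2,v_2)$ cross if $u_1<u_2<v_1<v_2$ or $u_2<u_1<v_2<v_1$. A book embedding of $G$ with $k$ pages consists of a topological ordering $<$ of $G$ (the spine ordering) and a partition of $E(G)$ into $k$ sets (pages) such that no page contains two edges that cross with respect to $<$. The page number $\operatorname{pn}(G)$ is the minimum $k$ for which $G$ admits a book embedding with $k$ pages. *)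

(* Defs.v *)
From mathcomp Require Import all_boot all_order all_algebra.
From mathcomp Require Import boolp classical_sets set_interval reals.
From mathcomp Require Import topology normedtype.

Set Implicit Arguments.
Unset Strict Implicit.
Unset Printing Implicit Defensive.

Import Order.TTheory GRing.Theory Num.Theory.
Import numFieldNormedType.Exports.

Local Open Scope classical_set_scope.

Record dag := Dag {
  vertex :> finType;
  edge : rel vertex;
  edge_acyclic : forall c : seq vertex, ucycle edge c -> c = [::]
}.

Arguments edge : clear implicits.

Definition edges (G : dag) : {set G * G} := [set p : G * G | edge G p.1 p.2]%SET.

Definition prec (G : dag) (u v : G) : bool := (u != v) && connect (edge G) u v.

Definition preceq (G : dag) (u v : G) : bool := prec u v || (u == v).

Definition incomparable (G : dag) (u v : G) : bool :=
  ~~ (preceq u v || preceq v u).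

Definition pairwise_incomparable (G : dag) (A : {set G}) : bool :=
  [forall u in A, forall v in A, (u != v) ==> incomparable u v].

Definition width (G : dag) : nat :=
  \max_(A : {set G} | pairwise_incomparable A) #|A|.

Section Drawing.
Variables (R : realType) (G : dag).
Local Open Scope ring_scope.

Definition upward_curve (p q : R * R) (c : R -> R * R) : Prop :=
  [/\ {within `[0, 1], continuous c},
      c 0 = p, c 1 = q &
      {in `[0, 1] &, {homo (fun t => (c t).2) : s t / s < t}}].

Definition trace (c : R -> R * R) : set (R * R) := c @` `[0, 1].

(* The values of [curve] outside [edges G] are irrelevant. The last clause is
   used for both (a, b) and (b, a): a common point of two distinct edges is an
   endpoint of each of them. *)
Definition upward_drawing (pos : G -> R * R) (curve : G * G -> R -> R * R) :
    Prop :=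
  [/\ injective pos,
      {in edges G, forall a, upward_curve (pos a.1) (pos a.2) (curve a)},
      {in edges G, forall a (x : G),
         trace (curve a) (pos x) -> x = a.1 \/ x = a.2} &
      {in edges G &, forall a b, a <> b -> forall z : R * R,
         trace (curve a) z -> trace (curve b) z ->
         z = pos a.1 \/ z = pos a.2}].

Definition upward_planar : Prop :=
  exists (pos : G -> R * R) (curve : G * G -> R -> R * R),
    upward_drawing pos curve.

End Drawing.

Arguments upward_planar : clear implicits.

Section Book.
Variable G : dag.

Definition topological_ordering (lt : rel G) : Prop :=
  [/\ irreflexive lt, transitive lt,
      forall u v, u != v -> lt u v || lt v u &
      forall u v, edge G u v -> lt u v].

Definition cross (lt : rel G) (a b : G * G) : bool :=
  [&& lt a.1 b.1, lt b.1 a.2 & lt a.2 b.2] ||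
  [&& lt b.1 a.1, lt a.1 b.2 & lt b.2 a.2].

(* The blocks of [partition] are nonempty; allowing empty pages would not change
   the minimum [page_number]. *)
Definition book_embedding (k : nat) (lt : rel G) (pages : {set {set G * G}}) :
    Prop :=
  [/\ topological_ordering lt,
      finset.partition pages (edges G), #|pages| = k &
      forall page, page \in pages ->
        {in page &, forall a b, ~~ cross lt a b}].

Definition has_book_embedding (k : nat) : Prop :=
  exists lt pages, book_embedding k lt pages.

Lemma edge_connectF (u v : G) : edge G u v -> connect (edge G) v u -> False.
Proof.
move=> uv /connectP[p vp up]; move: uv; rewrite {}up.
case/shortenP: vp => q vq uq _ qv.
have := @edge_acyclic G (v :: q); apply/boolp.not_implyP; split=> //.
by rewrite /ucycle /= rcons_path vq qv.
Qed.

Lemma topological_ordering_exists : exists lt, topological_ordering lt.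
Proof.
pose f (v : G) := #|[pred u | connect (edge G) u v]|.
pose lt := [rel u v : G | (f u < f v) ||
                          ((f u == f v) && (enum_rank u < enum_rank v))].
exists lt; split => /=.
- by move=> u; rewrite /= !ltnn andbF.
- move=> v u w /= /orP[uv|/andP[/eqP-> uv]] /orP[vw|/andP[/eqP<- vw]].
  + by rewrite (ltn_trans uv vw).
  + by rewrite uv.
  + by rewrite vw.
  + by rewrite eqxx (ltn_trans uv vw) orbT.
- move=> u v uv; case: (ltngtP (f u) (f v)) => //= _.
  by rewrite -neq_ltn; apply: contra uv => /eqP/val_inj/enum_rank_inj->.
- move=> u v uv; apply/orP; left; apply: proper_card; apply/properP; split.
    apply/fintype.subsetP => x; rewrite !inE => xu.
    exact: connect_trans xu (connect1 uv).
  exists v; rewrite !inE ?connect0 //.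
  by apply/negP => /(edge_connectF uv).
Qed.

Lemma book_embedding_exists : exists k, `[< has_book_embedding k >].
Proof.
have [lt ltP] := topological_ordering_exists.
pose pages := finset.preim_partition id (edges G).
exists #|pages|; apply/asboolP; exists lt, pages.
have part := finset.preim_partitionP id (edges G).
split=> // page pageP a b aP bP.
have -> : b = a.
  have tI : finset.trivIset pages by case/and3P: part.
  have aE : a \in edges G by rewrite -(finset.cover_partition part); apply/finset.bigcupP; exists page.
  have bE : b \in edges G by rewrite -(finset.cover_partition part); apply/finset.bigcupP; exists page.
  have := bP; rewrite -(finset.def_pblock tI pageP aP).
  by rewrite (finset.pblock_equivalence_partition _ aE bE) => [/eqP->|x y z _ _ _] //=;
    split=> // /eqP->.
case: ltP => irr tr _ _; rewrite /cross; apply/negP.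
by rewrite irr.
Qed.

Definition page_number : nat := ex_minn book_embedding_exists.

End Book.

Arguments page_number : clear implicits.

(* Main.v *)
(* Sweeping the drawing upwards, one equips the set of vertices and edges of [G]
   with two linear orders, given by rankings [L] and [R]. Their intersection
   [below] extends reachability, and [leftof], where they disagree, is a
   conjugate "left of" order; an edge is comparable exactly to the vertices below
   its tail or above its head, which encodes planarity.
   The heights of vertices with respect to [leftof] are less than the width, and
   they yield [width G] noncrossing maximal chains ("spines") covering [G], such
   that an edge either is a chord of one spine or joins two consecutive spines.
   If [e] joins two consecutive spines, we ask that its head precede those later
   vertices of its tail's spine that are incomparable to it. These requests concern
   pairs of [leftof]-neighbours, and planarity keeps them from conflicting, so
   that they can be met one at a time while keeping both orders linear. In the
   resulting spine ordering, the chords on one side of a spine do not cross, and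
   the edges of one direction between two consecutive spines need only two pages.
   This gives at most 6 (hence 14) pages per unit of width. *)
Require Import Defs.
From mathcomp Require Import all_boot all_order all_algebra.
From mathcomp Require Import boolp classical_sets set_interval reals.
From mathcomp Require Import topology normedtype realfun.
From mathcomp Require Import zify lra.

Set Implicit Arguments.
Unset Strict Implicit.
Unset Printing Implicit Defensive.

Import Order.TTheory GRing.Theory Num.Theory.
Import numFieldNormedType.Exports.

(** * The drawing *)

Section UpwardCurves.
Variable R : realType.
Local Open Scope classical_set_scope.
Local Open Scope ring_scope.

Lemma within_continuous_comp_in (T U V : topologicalType) (A : set T)
    (B : set U) (f : T -> U) (g : U -> V) :
  (forall x, A x -> B (f x)) -> {within A, continuous f} ->
  {within B, continuous g} -> {within A, continuous (g \o f)}.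
Proof.
move=> fAB /subspace_continuousP cf /subspace_continuousP cg.
apply/subspace_continuousP => x Ax W /= nW.
have := cg _ (fAB _ Ax) _ nW; rewrite /= /nbhs /= => nB.
have := cf _ Ax _ nB; rewrite /= /nbhs /= /within /=.
by apply: filterS => y h Ay; apply: (h Ay); apply: fAB.
Qed.

Variables (p q : R * R) (c : R -> R * R).
Hypothesis cP : upward_curve p q c.

Let mem01 (t : R) : (t \in `[0, 1]) = (0 <= t <= 1).
Proof. by rewrite in_itv. Qed.

Lemma snd_within_continuous : {within `[0, 1], continuous (snd \o c)}.
Proof.
case: cP => cc _ _ _ ; apply: (@within_continuous_comp_in _ _ _ _ setT) => //.
by apply: continuous_subspaceT => x; apply: cvg_snd.
Qed.

Lemma fst_within_continuous : {within `[0, 1], continuous (fst \o c)}.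
Proof.
case: cP => cc _ _ _ ; apply: (@within_continuous_comp_in _ _ _ _ setT) => //.
by apply: continuous_subspaceT => x; apply: cvg_fst.
Qed.

Lemma upward_curve_mono :
  {in `[0, 1] &, {mono (fun t => (c t).2) : s t / s <= t}}.
Proof.
case: cP => _ _ _ m; apply: le_mono_in => s t s01 t01; exact: m.
Qed.

Lemma upward_curve_inj : {in `[0, 1] &, injective (fun t => (c t).2)}.
Proof. exact: inc_inj_in upward_curve_mono. Qed.

Lemma upward_curve_lt : p.2 < q.2.
Proof.
by case: cP => _ <- <- m; apply: m; rewrite ?mem01 ?lexx ?ler01 ?ltr01.
Qed.

Lemma trace_height z : trace c z -> p.2 <= z.2 <= q.2.
Proof.
case=> t; rewrite /= mem01 => t01 <-.
have h0 : (0 : R) \in `[0, 1] by rewrite mem01 lexx ler01.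
have h1 : (1 : R) \in `[0, 1] by rewrite mem01 lexx ler01.
have ht : t \in `[0, 1] by rewrite mem01.
case: cP => _ <- <- _; rewrite (upward_curve_mono h0 ht).
by rewrite (upward_curve_mono ht h1).
Qed.

Lemma trace_ends : trace c p /\ trace c q.
Proof.
by case: cP => _ <- <- _; split; [exists 0|exists 1] => //=;
  rewrite mem01 ?lexx ler01.
Qed.

Lemma trace_uniq z z' : trace c z -> trace c z' -> z.2 = z'.2 -> z = z'.
Proof.
by case=> t t01 <- [t' t01' <-] /upward_curve_inj -> //.
Qed.

(** Every intermediate height is reached, and the inverse of the strictly increasing continuous
    height is continuous. So the curve is the graph of a continuous function of the height, to which
    the intermediate value theorem applies. *)
Lemma trace_function : exists f : R -> R,
  {within `[p.2, q.2], continuous f} /\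
  forall h, p.2 <= h <= q.2 -> trace c (f h, h).
Proof.
have surj h : p.2 <= h <= q.2 -> exists2 t, t \in `[0, 1] & (c t).2 = h.
  case: cP => _ <- <- _ hh; apply: (IVT ler01 snd_within_continuous).
  have le01 : (c 0).2 <= (c 1).2 by case/andP: hh; apply: le_trans.
  by rewrite /= (min_idPl le01) (max_idPr le01).
have [g gK] : exists g : R -> R, forall h, p.2 <= h <= q.2 ->
    g h \in `[0, 1] /\ (c (g h)).2 = h.
  have /choice[g gP] : forall h, exists t, p.2 <= h <= q.2 ->
      t \in `[0, 1] /\ (c t).2 = h.
    move=> h; case: (boolP (p.2 <= h <= q.2)) => [/surj[t t01 th]|_].
      by exists t.
    by exists 0.
  by exists g.
have cancel_g : {in `[0, 1], cancel (snd \o c) g}.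
  move=> t t01 /=; have tp : p.2 <= (c t).2 <= q.2.
    by apply: trace_height; exists t.
  have [g01 gE] := gK _ tp; exact: upward_curve_inj.
have gc : {within `[p.2, q.2], continuous g}.
  have := segment_can_le_continuous ler01 snd_within_continuous cancel_g.
  by case: cP => /= _ -> -> _.
exists (fst \o c \o g); split.
  apply: within_continuous_comp_in gc fst_within_continuous => h /=.
  by rewrite in_itv /= => /gK[].
move=> h /gK[g01 gE]; exists (g h) => //.
by rewrite /=; case: (c (g h)) gE => a b /= ->.
Qed.

End UpwardCurves.

Section Drawing.
Variables (R : realType) (G : dag).
Variables (pos : G -> R * R) (curve : G * G -> R -> R * R).
Hypothesis drawing : upward_drawing pos curve.
Local Open Scope classical_set_scope.
Local Open Scope ring_scope.

Local Notation height v := (pos v).2.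

(** A single common height is enough: by [left_at_asym], two distinct edges never change sides. *)
Definition left_at (e f : G * G) : Prop := exists x x' h,
  [/\ trace (curve e) (x, h), trace (curve f) (x', h) & x < x'].

Lemma drawing_curve e : e \in edges G ->
  upward_curve (pos e.1) (pos e.2) (curve e).
Proof. by case: drawing => _ h _ _ /h. Qed.

Lemma edge_height e : e \in edges G -> height e.1 < height e.2.
Proof. by move/drawing_curve/upward_curve_lt. Qed.

Lemma common_height e f z : e \in edges G -> f \in edges G -> e <> f ->
  trace (curve e) z -> trace (curve f) z ->
  (z.2 = height e.1 \/ z.2 = height e.2) /\
  (z.2 = height f.1 \/ z.2 = height f.2).
Proof.
move=> eE fE ef ez fz; case: drawing => _ _ _ cd.
have fe : f <> e by move=> fe; apply: ef.
split; [case: (cd _ _ eE fE ef _ ez fz) | case: (cd _ _ fE eE fe _ fz ez)] => ->;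
  by [left | right].
Qed.

Lemma trace_at e h : e \in edges G -> height e.1 <= h <= height e.2 ->
  exists x, trace (curve e) (x, h).
Proof.
by move=> /drawing_curve/trace_function[f [_ fP]] /fP; exists (f h).
Qed.

(** The difference of abscissas changes sign, so it vanishes strictly between [h1] and [h2]. The
    curves would meet there, away from the ends of [e]. *)
Let crossing e f x1 x1' h1 x2 x2' h2 : e \in edges G -> f \in edges G ->
  e <> f -> h1 < h2 ->
  trace (curve e) (x1, h1) -> trace (curve f) (x1', h1) ->
  trace (curve e) (x2, h2) -> trace (curve f) (x2', h2) ->
  (x1 - x1') * (x2 - x2') < 0 -> False.
Proof.
move=> eE fE ef h12 e1 f1 e2 f2 sg.
have ce := drawing_curve eE; have cf := drawing_curve fE.
have [F [Fc FP]] := trace_function ce; have [F' [F'c F'P]] := trace_function cf.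
have /= /andP[he1 _] := trace_height ce e1.
have /= /andP[_ he2] := trace_height ce e2.
have /= /andP[hf1 _] := trace_height cf f1.
have /= /andP[_ hf2] := trace_height cf f2.
have FE h x : h1 <= h <= h2 -> trace (curve e) (x, h) -> x = F h.
  move=> /andP[l1 l2] t.
  have th : trace (curve e) (F h, h).
    by apply: FP; rewrite (le_trans he1 l1) (le_trans l2 he2).
  by have [] := trace_uniq ce t th erefl.
have FE' h x : h1 <= h <= h2 -> trace (curve f) (x, h) -> x = F' h.
  move=> /andP[l1 l2] t.
  have th : trace (curve f) (F' h, h).
    by apply: F'P; rewrite (le_trans hf1 l1) (le_trans l2 hf2).
  by have [] := trace_uniq cf t th erefl.
have b1 : h1 <= h1 <= h2 by rewrite lexx ltW.
have b2 : h1 <= h2 <= h2 by rewrite lexx ltW.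
rewrite (FE _ _ b1 e1) (FE _ _ b2 e2) (FE' _ _ b1 f1) (FE' _ _ b2 f2) in sg.
have dc : {within `[h1, h2], continuous (fun h => F h - F' h)}.
  apply: (@within_continuousB _ _ R _ F F').
    apply: continuous_subspaceW Fc => h /=; rewrite !in_itv /= => /andP[l1 l2].
    by rewrite (le_trans he1 l1) (le_trans l2 he2).
  apply: continuous_subspaceW F'c => h /=; rewrite !in_itv /= => /andP[l1 l2].
  by rewrite (le_trans hf1 l1) (le_trans l2 hf2).
have [|h] := @IVT _ (fun h => F h - F' h) h1 h2 0 (ltW h12) dc.
  have [a0|a0] := ltP (F h1 - F' h1) 0.
    have b0 : 0 < F h2 - F' h2 by rewrite -(nmulr_rlt0 _ a0).
    by rewrite ge_min le_max ltW //= (ltW b0) orbT.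
  have {}a0 : 0 < F h1 - F' h1.
    by rewrite lt_def a0 andbT; apply: contraTneq sg => ->; rewrite mul0r ltxx.
  have b0 : F h2 - F' h2 < 0 by rewrite -(pmulr_rlt0 _ a0).
  by rewrite ge_min le_max (ltW b0) (ltW a0) orbT.
rewrite in_itv /= => hh /eqP; rewrite subr_eq0 => /eqP FF.
have hn1 : h != h1.
  by apply: contraTneq sg => <-; rewrite FF subrr mul0r ltxx.
have hn2 : h != h2.
  by apply: contraTneq sg => <-; rewrite FF subrr mulr0 ltxx.
have lh1 : h1 < h by case/andP: hh => l _; rewrite lt_def hn1.
have lh2 : h < h2 by case/andP: hh => _ l; rewrite lt_def eq_sym hn2.
have te : trace (curve e) (F h, h).
  by apply: FP; rewrite (le_trans he1 (ltW lh1)) (le_trans (ltW lh2) he2).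
have tf : trace (curve f) (F h, h).
  by rewrite FF; apply: F'P; rewrite (le_trans hf1 (ltW lh1)) (le_trans (ltW lh2) hf2).
have [[] /= hE _] := common_height eE fE ef te tf.
  by have := le_lt_trans he1 lh1; rewrite hE ltxx.
by have := lt_le_trans lh2 he2; rewrite hE ltxx.
Qed.

Lemma left_at_asym e f : e \in edges G -> f \in edges G -> e <> f ->
  left_at e f -> left_at f e -> False.
Proof.
move=> eE fE ef [x1 [x1' [h1 [e1 f1 l1]]]] [x2 [x2' [h2 [f2 e2 l2]]]].
have [h12|h12|h12] := ltrgtP h1 h2.
- apply: (crossing eE fE ef h12 e1 f1 e2 f2).
  by rewrite nmulr_rlt0 ?subr_gt0 // subr_lt0.
- apply: (crossing eE fE ef h12 e2 f2 e1 f1).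
  by rewrite pmulr_rlt0 ?subr_lt0 // subr_gt0.
- subst h2; have [E] := trace_uniq (drawing_curve eE) e1 e2 erefl.
  have [E'] := trace_uniq (drawing_curve fE) f1 f2 erefl.
  by move: l1 l2; rewrite E E' => /ltW; rewrite leNgt => /negP.
Qed.

Lemma vertex_side e w : e \in edges G -> height e.1 <= height w <= height e.2 ->
  w <> e.1 -> w <> e.2 ->
  exists2 x, trace (curve e) (x, height w) & x < (pos w).1 \/ (pos w).1 < x.
Proof.
move=> eE hw w1 w2; have [x xP] := trace_at eE hw; exists x => //.
have [|l|E] := ltrgtP x (pos w).1; [by left|by right|exfalso].
case: drawing => _ _ vd _; have := vd _ eE w.
have -> : pos w = (x, height w) by rewrite E -surjective_pairing.
by case/(_ xP).
Qed.

Lemma tail_trace e : e \in edges G -> trace (curve e) (pos e.1).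
Proof. by move/drawing_curve/trace_ends => []. Qed.

Lemma head_trace e : e \in edges G -> trace (curve e) (pos e.2).
Proof. by move/drawing_curve/trace_ends => []. Qed.

(* The key is the abscissa of the curve just above the common tail. *)
Lemma out_edges_key w : exists key : G * G -> R,
  forall e f, e \in edges G -> f \in edges G -> e.1 = w -> f.1 = w ->
  (key e < key f -> left_at e f) /\ (key e = key f -> e = f).
Proof.
(* No out-edge of [w] ends below [h1]; the initial value keeps [h1] above [w] even without
   out-edges. At the height [h] halfway up to [h1], all out-edges are present and none has ended. *)
pose h1 := \big[Num.min/height w + 1]_(e in edges G | e.1 == w) height e.2.
have h1P e : e \in edges G -> e.1 = w -> h1 <= height e.2.
  by move=> eE ew; apply: bigmin_le_cond; rewrite eE ew eqxx.
have wh1 : height w < h1.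
  rewrite /h1; elim/big_ind: _ => [||e /andP[eE /eqP<-]]; first by rewrite ltrDl.
    by move=> x y hx hy; rewrite lt_min hx.
  exact: edge_height.
pose h := (height w + h1) / 2.
have wh : height w < h by rewrite /h; lra.
have hh1 : h < h1 by rewrite /h; lra.
have [key keyP] : exists key : G * G -> R, forall e, e \in edges G -> e.1 = w ->
    trace (curve e) (key e, h).
  have /choice[key kP] : forall e, exists x, e \in edges G -> e.1 = w ->
      trace (curve e) (x, h).
    move=> e; case: (boolP ((e \in edges G) && (e.1 == w))) => [|ew].
      move=> /andP[eE /eqP ew].
      have [|x xP] := @trace_at e h eE; last by exists x.
      by rewrite ew (ltW wh) (le_trans (ltW hh1) (h1P _ eE ew)).
    by exists 0 => eE /eqP ew'; rewrite eE ew' in ew.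
  by exists key.
exists key => e f eE fE ew fw; split=> [lt_ef|E].
  by exists (key e), (key f), h; split=> //; apply: keyP.
apply: contrapT => ef.
have te := keyP _ eE ew; have tf := keyP _ fE fw; rewrite -E in tf.
have [[] /= hE _] := common_height eE fE ef te tf.
  by move: wh; rewrite hE ew ltxx.
by have := lt_le_trans hh1 (h1P _ eE ew); rewrite -hE ltxx.
Qed.

End Drawing.

(** * Sweeping *)

Section Ranks.
Variables (X : Type) (L R : X -> nat).
Local Open Scope nat_scope.

Definition below x y := (L x < L y) && (R x < R y).
Definition beloweq x y := (L x <= L y) && (R x <= R y).
Definition leftof x y := (L x < L y) && (R y < R x).

End Ranks.

Ltac ranks := rewrite ?/below ?/beloweq ?/leftof /=; clear; lia.

(** The new elements enter as a block, sorted by [off], just before the old rank [c]. Old ranks go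
    to odd multiples of [M]; the block starts at the even multiple [2 * c * M] and is shorter than
    [M]. *)
Lemma insert_ranks (X : finType) (new : pred X) (L off : X -> nat) (c : nat) :
  exists L' : X -> nat,
  [/\ forall x y, ~~ new x -> ~~ new y -> (L' x < L' y) = (L x < L y),
      forall x y, ~~ new x -> new y -> (L' x < L' y) = (L x < c),
      forall x y, ~~ new x -> new y -> (L' y < L' x) = (c <= L x) &
      forall x y, new x -> new y -> (L' x < L' y) = (off x < off y)].
Proof.
pose M := (\max_x off x).+1.
have offM x : off x < M by rewrite ltnS leq_bigmax.
exists (fun x => if new x then c.*2 * M + off x else (L x).*2.+1 * M).
split=> x y nx ny.
- by rewrite (negPf nx) (negPf ny) ltn_pmul2r // ltnS ltn_double.
- rewrite (negPf nx) ny; have o := offM y; apply/idP/idP => h; nia.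
- rewrite (negPf nx) ny; have o := offM y; apply/idP/idP => h; nia.
- by rewrite nx ny ltn_add2l.
Qed.

Section Sweep.
Variable G : dag.
Local Open Scope nat_scope.
Implicit Types (D : {set G}) (e f : G * G) (x y : G + G * G).

Definition present D x : bool :=
  match x with
  | inl v => v \in D
  | inr e => (e \in edges G) && (e.1 \in D)
  end.

(* The state of an upward sweep after the vertices of [D]: the edges [e] with
   [e.1 \in D] and [e.2 \notin D] are those cut by the sweep line. [below]
   extends reachability, as if edges had been added to make [G] an st-graph. *)
Record swept (lft : G * G -> G * G -> Prop) D (L R : G + G * G -> nat) :
    Prop := Swept {
  swept_injL : {in present D &, injective L};
  swept_injR : {in present D &, injective R};
  swept_tail : forall e, e \in edges G -> e.1 \in D ->
    below L R (inl e.1) (inr e);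
  swept_head : forall e, e \in edges G -> e.1 \in D -> e.2 \in D ->
    below L R (inr e) (inl e.2);
  swept_below : forall e x, e \in edges G -> e.1 \in D -> present D x ->
    below L R x (inr e) -> beloweq L R x (inl e.1);
  swept_above : forall e x, e \in edges G -> e.1 \in D -> present D x ->
    below L R (inr e) x -> e.2 \in D /\ beloweq L R (inl e.2) x;
  swept_left : forall e f, e \in edges G -> e.1 \in D -> e.2 \notin D ->
    f \in edges G -> f.1 \in D -> f.2 \notin D -> e <> f -> lft e f ->
    leftof L R (inr e) (inr f)
}.

End Sweep.

Section SweepDrawing.
Variables (K : realType) (G : dag).
Variables (pos : G -> K * K) (curve : G * G -> K -> K * K).
Hypothesis drawing : upward_drawing pos curve.
Implicit Types (D : {set G}) (e f : G * G) (x y : G + G * G).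

Local Notation height v := (pos v).2.
Let lft := left_at curve.

Definition left_of_vertex e w :=
  exists2 x, trace (curve e) (x, height w) & (x < (pos w).1)%R.
Definition right_of_vertex e w :=
  exists2 x, trace (curve e) (x, height w) & ((pos w).1 < x)%R.

(** * Adding the next vertex to the sweep *)

Section Step.
Variables (D : {set G}) (w : G) (L R : G + G * G -> nat).
Hypothesis inv : swept lft D L R.
Hypothesis wD : w \notin D.
Hypothesis D_le : forall u, u \in D -> (height u <= height w)%R.
Hypothesis le_ND : forall u, u \notin D -> (height w <= height u)%R.

Let open e := [&& e \in edges G, e.1 \in D & e.2 \notin D].

Lemma in_edge_open e : e \in edges G -> e.2 = w -> open e.
Proof.
move=> eE ew; rewrite /open eE ew wD andbT; apply: contraT => /le_ND.
by rewrite leNgt -ew (edge_height drawing).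
Qed.

Lemma open_side e : open e -> e.2 != w ->
  left_of_vertex e w \/ right_of_vertex e w.
Proof.
move=> /and3P[eE e1 e2] ew.
have hw : (height e.1 <= height w <= height e.2)%R by rewrite D_le ?le_ND.
have w1 : w <> e.1 by move=> we; move: wD; rewrite we e1.
have w2 : w <> e.2 by move=> we; rewrite we eqxx in ew.
have [x xP [l|l]] := vertex_side drawing eE hw w1 w2; by [left; exists x|right; exists x].
Qed.

Lemma in_edge_trace e : e \in edges G -> e.2 = w ->
  trace (curve e) ((pos w).1, height w).
Proof.
by move=> eE <-; rewrite -surjective_pairing; exact: head_trace.
Qed.

(* Where [w] enters the two rankings: [x] is to be below [w] when [L x < cL]
   and [R x < cR]. *)
Lemma insertion_thresholds : exists cL cR : nat,
  [/\ forall e, e \in edges G -> e.2 = w -> L (inr e) < cL /\ R (inr e) < cR,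
      forall x, present D x -> cL <= L x -> cR <= R x -> False,
      forall e, e \in edges G -> e.1 \in D -> L (inr e) < cL ->
        R (inr e) < cR -> e.2 = w \/
        [/\ e.2 \in D, L (inl e.2) < cL & R (inl e.2) < cR],
      forall e, open e -> left_of_vertex e w ->
        L (inr e) < cL /\ cR <= R (inr e) &
      forall e, open e -> right_of_vertex e w ->
        cL <= L (inr e) /\ R (inr e) < cR].
Proof.
have injL := swept_injL inv; have injR := swept_injR inv.
have pres e : open e -> present D (inr e) by case/and3P=> /= -> ->.
have above_open e x : open e -> present D x -> ~ below L R (inr e) x.
  move=> /and3P[eE e1 e2] px /(swept_above inv eE e1 px)[e2' _].
  by rewrite e2' in e2.
have neq_inr e f : e <> f -> inr e <> inr f :> G + G * G by move=> ef [].
have lft_open e f : open e -> open f -> e <> f -> lft e f ->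
    leftof L R (inr e) (inr f).
  by move=> /and3P[? ? ?] /and3P[? ? ?]; exact: (swept_left inv).
(* Three cases: [w] has an in-edge; it has none, but some cut edge passes to its left; neither. *)
have [e0 /andP[e0E /eqP e0w]|no_in] := pickP [pred e | (e \in edges G) && (e.2 == w)].
- pose Pin := [pred e | (e \in edges G) && (e.2 == w)].
  have Pe0 : Pin e0 by rewrite /= e0E e0w eqxx.
  have PinP e : Pin e -> [/\ e \in edges G, e.2 = w & open e].
    by move=> /andP[eE /eqP ew]; split=> //; apply: in_edge_open.
  (* Along the cut [L] grows and [R] decreases from left to right, so [b] is the rightmost in-edge
     and [a] the leftmost. The thresholds come just after [b] in [L] and just after [a] in [R]. *)
  pose b := [arg max_(e > e0 | Pin e) L (inr e)].
  pose a := [arg max_(e > e0 | Pin e) R (inr e)].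
  have [bP bmax] : Pin b /\ forall e, Pin e -> L (inr e) <= L (inr b).
    by rewrite /b; case: arg_maxnP => // i Pi mi; split.
  have [aP amax] : Pin a /\ forall e, Pin e -> R (inr e) <= R (inr a).
    by rewrite /a; case: arg_maxnP => // i Pi mi; split.
  have [bE bw bo] := PinP _ bP; have [aE aw ao] := PinP _ aP.
  have Lab := bmax _ aP; have Rba := amax _ bP.
  have left_in e f : open e -> e.2 != w -> Pin f -> left_of_vertex e w ->
      leftof L R (inr e) (inr f).
    move=> eo ew fP [x xP lx]; have [fE fw fo] := PinP _ fP.
    apply: lft_open => //; first by move=> E; rewrite E fw eqxx in ew.
    by exists x, (pos w).1, (height w); split=> //; apply: in_edge_trace.
  have right_in e f : open e -> e.2 != w -> Pin f -> right_of_vertex e w ->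
      leftof L R (inr f) (inr e).
    move=> eo ew fP [x xP lx]; have [fE fw fo] := PinP _ fP.
    apply: lft_open => //; first by move=> E; rewrite -E fw eqxx in ew.
    by exists (pos w).1, x, (height w); split=> //; apply: in_edge_trace.
  have in_side e : open e -> left_of_vertex e w \/ right_of_vertex e w ->
      e.2 != w.
    move=> /and3P[eE _ _] s; apply/eqP => ew; have t := in_edge_trace eE ew.
    by case: s => -[x xP];
      have [->] := trace_uniq (drawing_curve drawing eE) xP t erefl; rewrite ltxx.
  exists (L (inr b)).+1, (R (inr a)).+1; split.
  + move=> e eE ew; have eP : Pin e by rewrite /= eE ew eqxx.
    by rewrite !ltnS bmax ?amax.
  + move=> x px lx rx; apply: (above_open b x) => //.
    by rewrite /below lx (leq_ltn_trans Rba).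
  + move=> e eE e1; rewrite !ltnS => lx rx.
    have [->|ew] := eqVneq e.2 w; [by left|right].
    have pe : present D (inr e) by rewrite /= eE.
    have [e2|e2] := boolP (e.2 \in D); last first.
      exfalso; have eo : open e by rewrite /open eE e1.
      case: (open_side eo ew) => s.
        by have /andP[_] := left_in _ _ eo ew aP s; rewrite ltnNge rx.
      by have /andP[+ _] := right_in _ _ eo ew bP s; rewrite ltnNge lx.
    have pv : present D (inl e.2) by [].
    have /andP[lev rev] := swept_head inv eE e1 e2.
    have nb : e <> b by move=> E; rewrite E bw eqxx in ew.
    have na : e <> a by move=> E; rewrite E aw eqxx in ew.
    have nbL : L (inr e) <> L (inr b) by move/(injL _ _ pe (pres _ bo)); exact: neq_inr.
    have naR : R (inr e) <> R (inr a) by move/(injR _ _ pe (pres _ ao)); exact: neq_inr.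
    have nbv := above_open _ _ bo pv; have nav := above_open _ _ ao pv.
    (* Suppose the head of [e] is beyond [b] in [L]. As it is not above [b], it precedes [b] in [R],
       so [e] is below [b], and by [swept_above] so is its head, a contradiction. The edge [a] does
       the same for [R]. *)
    split=> //; rewrite leqNgt; apply/negP => lt.
      have rvb : R (inl e.2) <= R (inr b).
        by rewrite leqNgt; apply/negP => rb; apply: nbv; rewrite /below lt.
      have eb : below L R (inr e) (inr b).
        by rewrite /below ltn_neqAle lx (leq_trans rev rvb) !andbT; exact/eqP.
      have [_ /andP[+ _]] := swept_above inv eE e1 (pres _ bo) eb.
      by rewrite leqNgt lt.
    have lva : L (inl e.2) <= L (inr a).
      by rewrite leqNgt; apply/negP => la; apply: nav; rewrite /below lt la.
    have ea : below L R (inr e) (inr a).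
      by rewrite /below [R _ < _]ltn_neqAle rx (leq_trans lev lva) !andbT; exact/eqP.
    have [_ /andP[_]] := swept_above inv eE e1 (pres _ ao) ea.
    by rewrite leqNgt lt.
  + move=> e eo s; have ew : e.2 != w by apply: in_side => //; left.
    have /andP[_ ->] := left_in _ _ eo ew aP s.
    by have /andP[+ _] := left_in _ _ eo ew bP s; rewrite ltnS => /ltnW.
  + move=> e eo s; have ew : e.2 != w by apply: in_side => //; right.
    have /andP[_ +] := right_in _ _ eo ew aP s.
    by have /andP[-> _] := right_in _ _ eo ew bP s; rewrite ltnS => /ltnW.
have no_in_edge e : e \in edges G -> e.2 = w -> False.
  by move=> eE ew; have := no_in e; rewrite /= eE ew eqxx.
pose Pl := [pred e | open e && `[< left_of_vertex e w >]].
have [g0 g0P|no_left] := pickP Pl.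
(* A source is inserted immediately to the right of the last cut edge on its left: just after [g] in
   [L] and just before it in [R]. *)
- pose g := [arg max_(e > g0 | Pl e) L (inr e)].
  have [gP gmax] : Pl g /\ forall e, Pl e -> L (inr e) <= L (inr g).
    by rewrite /g; case: arg_maxnP => // i Pi mi; split.
  have /andP[go /asboolP gl] := gP; have pg := pres _ go.
  have below_g e : e \in edges G -> e.1 \in D -> L (inr e) <= L (inr g) ->
      R (inr e) < R (inr g) -> e.2 \in D /\ beloweq L R (inl e.2) (inr g).
    move=> eE e1 lx rx; have pe : present D (inr e) by rewrite /= eE.
    apply: (swept_above inv eE e1 pg); rewrite /below rx andbT ltn_neqAle lx andbT.
    by apply/eqP => /(injL _ _ pe pg) E; rewrite E ltnn in rx.
  exists (L (inr g)).+1, (R (inr g)); split.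
  + by move=> e eE /(no_in_edge e eE).
  + move=> x px lx rx; apply: (above_open g x) => //.
    rewrite /below lx ltn_neqAle rx andbT; apply/eqP => /(injR _ _ pg px) E.
    by rewrite E ltnn in lx.
  + move=> e eE e1; rewrite ltnS => lx rx; right.
    have [e2 /andP[lv rv]] := below_g _ eE e1 lx rx.
    have pv : present D (inl e.2) by [].
    split=> //; rewrite ltn_neqAle rv andbT; apply/eqP => E.
    by have := injR _ _ pv pg E.
  + move=> e eo el; have lx : L (inr e) <= L (inr g).
      by apply: gmax; rewrite /= eo; apply/asboolP.
    split=> //; rewrite leqNgt; apply/negP => rx.
    have /and3P[eE e1 /negP e2] := eo.
    by have [/e2] := below_g _ eE e1 lx rx.
  + move=> e eo [x' x'P lx']; case: gl => x xP lx.
    have eg : g <> e.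
      move=> E; rewrite E in xP; have /and3P[eE _ _] := eo.
      have [E'] := trace_uniq (drawing_curve drawing eE) xP x'P erefl.
      by have := lt_trans lx lx'; rewrite E' ltxx.
    have ge : lft g e.
      by exists x, x', (height w); split=> //; apply: lt_trans lx lx'.
    by have /andP[-> ->] := lft_open _ _ go eo eg ge.
(* With nothing on its left, the source becomes leftmost: first in [L] and last in [R]. *)
exists 0, (\max_x R x).+1; split=> //.
- by move=> e eE /(no_in_edge e eE).
- by move=> x _ _; rewrite ltnNge leq_bigmax.
- move=> e eo el; have := no_left e.
  by rewrite /= eo; have -> : `[< left_of_vertex e w >] by apply/asboolP.
- by move=> e _ _; rewrite ltnS leq_bigmax.
Qed.

Lemma sweep_step : exists L' R' : G + G * G -> nat, swept lft (w |: D) L' R'.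
Proof.
have [cL [cR [t_in t_max t_below t_left t_right]]] := insertion_thresholds.
have [key keyP] := out_edges_key drawing w.
pose new x := match x with inl v => v == w | inr e => e.1 == w end.
(* The position of [e] among the out-edges of [w], counted from the left. *)
pose rk e := #|[set f in edges G | (f.1 == w) && (key f < key e)%R]|.
pose N := #|{: G * G}|.
have rkN e : rk e <= N by apply: max_card.
have rk_lt e f : e \in edges G -> e.1 = w -> (key e < key f)%R -> rk e < rk f.
  move=> eE ew ef; apply: proper_card; apply/fintype.properP; split.
    apply/fintype.subsetP => g; rewrite !inE => /and3P[-> -> /= ge].
    exact: lt_trans ge ef.
  by exists e; rewrite inE ?ltxx ?andbF // eE ew eqxx.
have rk_inj e f : e \in edges G -> f \in edges G -> e.1 = w -> f.1 = w ->
    rk e = rk f -> e = f.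
  move=> eE fE ew fw E; apply: (proj2 (keyP _ _ eE fE ew fw)).
  have [/(rk_lt _ _ eE ew)|/(rk_lt _ _ fE fw)|//] := ltrgtP (key e) (key f);
    by rewrite E ltnn.
(* In both orders [w] starts the block; its out-edges follow from left to right in [L] and from
   right to left in [R]. *)
pose offL x := if x is inr e then (rk e).+1 else 0.
pose offR x := if x is inr e then (N - rk e).+1 else 0.
have [L' [Loo Lon Lno Lnn]] := insert_ranks new L offL cL.
have [R' [Roo Ron Rno Rnn]] := insert_ranks new R offR cR.
have Lle x y : ~~ new x -> ~~ new y -> (L' x <= L' y) = (L x <= L y).
  by move=> nx ny; rewrite leqNgt Loo // -leqNgt.
have Rle x y : ~~ new x -> ~~ new y -> (R' x <= R' y) = (R x <= R y).
  by move=> nx ny; rewrite leqNgt Roo // -leqNgt.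
have pold x : present (w |: D) x -> ~~ new x -> present D x.
  by case: x => [v|e] /=; rewrite !inE => + /negPf n; rewrite n.
have inD v : v \in w |: D -> v != w -> v \in D by rewrite !inE => /orP[->|].
have eq_irr (f : G + G * G -> nat) x y : f x = f y ->
    (f x < f y) = false /\ (f y < f x) = false.
  by move=> ->; rewrite ltnn.
have out_antisym e f : e.1 = w -> f.1 = w -> ~ below L' R' (inr e) (inr f).
  move=> /eqP ew /eqP fw; rewrite /below Lnn // Rnn //= !ltnS => /andP[].
  by have := rkN e; have := rkN f; lia.
have asym e f : e \in edges G -> f \in edges G -> e <> f ->
    lft e f -> lft f e -> False.
  by move=> *; apply: (left_at_asym drawing (e := e) (f := f)).
exists L', R'; split.
- move=> x y px py /eq_irr.
  have [nx|nx] := boolP (new x); have [ny|ny] := boolP (new y).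
  + rewrite !Lnn // => -[]; case: x px nx => [v|e] px nx; case: y py ny => [u|f] py ny //=.
      by move: nx ny => /= /eqP-> /eqP->.
    rewrite !ltnS => h1 h2; congr inr; move: px py nx ny => /= /andP[eE _] /andP[fE _] /eqP ew /eqP fw.
    by apply: rk_inj => //; lia.
  + by rewrite (Lno _ _ ny nx) (Lon _ _ ny nx); case: leqP => _ [].
  + by rewrite (Lon _ _ nx ny) (Lno _ _ nx ny); case: leqP => _ [].
  + rewrite !Loo // => -[h1 h2]; apply: (swept_injL inv); rewrite ?inE; [exact: pold|exact: pold|lia].
- move=> x y px py /eq_irr.
  have [nx|nx] := boolP (new x); have [ny|ny] := boolP (new y).
  + rewrite !Rnn // => -[]; case: x px nx => [v|e] px nx; case: y py ny => [u|f] py ny //=.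
      by move: nx ny => /= /eqP-> /eqP->.
    rewrite !ltnS => h1 h2; congr inr; move: px py nx ny => /= /andP[eE _] /andP[fE _] /eqP ew /eqP fw.
    by apply: rk_inj => //; have := rkN e; have := rkN f; lia.
  + by rewrite (Rno _ _ ny nx) (Ron _ _ ny nx); case: leqP => _ [].
  + by rewrite (Ron _ _ nx ny) (Rno _ _ nx ny); case: leqP => _ [].
  + rewrite !Roo // => -[h1 h2]; apply: (swept_injR inv); rewrite ?inE; [exact: pold|exact: pold|lia].
- move=> e eE e1; have [ew|ew] := boolP (e.1 == w).
    by rewrite /below Lnn ?Rnn.
  by rewrite /below Loo ?Roo //; apply: (swept_tail inv) => //; apply: inD.
- move=> e eE e1 e2.
  have he := edge_height drawing eE.
  have [/eqP e2w|e2w] := boolP (e.2 == w).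
    have e1w : e.1 != w by apply: contraTneq he => ->; rewrite e2w ltxx.
    by rewrite /below Lon ?Ron //= ?e2w //; apply/andP; exact: t_in.
  have {}e2 := inD _ e2 e2w.
  have e1w : e.1 != w.
    by apply: contraTneq he => ->; rewrite -leNgt D_le.
  by rewrite /below Loo ?Roo //; apply: (swept_head inv) => //; apply: inD.
- move=> e x eE e1 px; have [/eqP ew|ew] := boolP (e.1 == w).
    have [nx|nx] := boolP (new x).
      case: x px nx => [v|f] px /eqP nx.
        by rewrite nx ew /beloweq !leqnn.
      by move/(out_antisym _ _ nx ew).
    have ne : new (inr e) by rewrite /= ew.
    have nt : new (inl e.1) by rewrite /= ew.
    rewrite /below (Lon _ _ nx ne) (Ron _ _ nx ne) => /andP[lx rx].
    by apply/andP; split; apply: ltnW; rewrite ?(Lon _ _ nx nt) ?(Ron _ _ nx nt).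
  have {}e1 := inD _ e1 ew.
  have [nx|nx] := boolP (new x).
    rewrite /below Lno ?Rno // => /andP[lx rx].
    by case: (t_max (inr e)) => //=; rewrite eE.
  rewrite /below Loo ?Roo // => xe.
  have /andP[lx rx] := swept_below inv eE e1 (pold _ px nx) xe.
  by rewrite /beloweq Lle ?Rle // lx.
- move=> e x eE e1 px; have [/eqP ew|ew] := boolP (e.1 == w).
    have [nx|nx] := boolP (new x).
      case: x px nx => [v|f] px /eqP nx.
        by rewrite /below Lnn ?ltn0 //= ?nx ?ew.
      by move/(out_antisym _ _ ew nx).
    have ne : new (inr e) by rewrite /= ew.
    rewrite /below Lno // Rno // => /andP[lx rx].
    by case: (t_max x) => //; apply: pold.
  have {}e1 := inD _ e1 ew.
  have [nx|nx] := boolP (new x).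
    rewrite /below Lon // Ron // => /andP[lx rx].
    case: (t_below e eE e1 lx rx) => [e2|[e2 l2 r2]].
      rewrite e2 !inE eqxx; split=> //.
      by apply/andP; split; rewrite leqNgt ?Lnn ?Rnn //= eqxx.
    rewrite !inE e2 orbT; split=> //.
    have n2 : ~~ new (inl e.2) by rewrite /=; apply: contraNneq wD => <-.
    by apply/andP; split; apply: ltnW; rewrite ?Lon ?Ron.
  rewrite /below Loo ?Roo // => xe.
  have [e2 /andP[lx rx]] := swept_above inv eE e1 (pold _ px nx) xe.
  rewrite !inE e2 orbT; split=> //.
  have n2 : ~~ new (inl e.2) by rewrite /=; apply: contraNneq wD => <-.
  by rewrite /beloweq Lle ?Rle // lx.
(* Out-edges of [w] are compared by their keys. A new and an old edge are compared at the height of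
   [w], where the wrong side would contradict [lft e f]. *)
move=> e f eE e1 e2 fE f1 f2 ef lef.
move: e2 f2; rewrite !inE !negb_or => /andP[e2w e2] /andP[f2w f2].
have tailw g : g \in edges G -> g.1 = w -> trace (curve g) ((pos w).1, height w).
  by move=> gE <-; rewrite -surjective_pairing; exact: (tail_trace drawing).
have [/eqP ew|ew] := boolP (e.1 == w); have [/eqP fw|fw] := boolP (f.1 == w).
- have [h _] := keyP _ _ eE fE ew fw; have [h' _] := keyP _ _ fE eE fw ew.
  have := rkN f.
  have [kef|kfe|kE] := ltrgtP (key e) (key f).
  + have := rk_lt _ _ eE ew kef.
    by rewrite /leftof Lnn ?Rnn //= ?ew ?fw // !ltnS => h1 h2;
      rewrite h1 ltn_sub2l // (leq_trans h1).
  + by case: (asym _ _ eE fE ef lef); apply: h'.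
  + by case: ef; apply: (proj2 (keyP _ _ eE fE ew fw)).
- have {}f1 := inD _ f1 fw.
  have fo : open f by rewrite /open fE f1.
  have [[x xP lx]|s] := open_side fo f2w.
    case: (asym _ _ eE fE ef lef).
    by exists x, (pos w).1, (height w); split=> //; apply: tailw.
  have [lf rf] := t_right _ fo s.
  by rewrite /leftof Lno ?Ron //= ?ew ?lf.
- have {}e1 := inD _ e1 ew.
  have eo : open e by rewrite /open eE e1.
  have [s|[x xP lx]] := open_side eo e2w; last first.
    case: (asym _ _ eE fE ef lef).
    by exists (pos w).1, x, (height w); split=> //; apply: tailw.
  have [le re] := t_left _ eo s.
  by rewrite /leftof Lon ?Rno //= ?fw ?le.
- rewrite /leftof Loo ?Roo //; apply: (swept_left inv) => //; exact: inD.
Qed.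

End Step.

(** Vertices enter by increasing height, those of equal height in any order. *)
Lemma sweep_all : exists L R : G + G * G -> nat, swept lft [set: G]%SET L R.
Proof.
suff [D [L [R [D_card _ inv]]]] : exists D (L R : G + G * G -> nat),
    [/\ #|D| = #|G|,
        forall u v, u \in D -> v \notin D -> (height u <= height v)%R &
        swept lft D L R].
  exists L, R; suff <- : D = [set: G]%SET by [].
  by apply/eqP; rewrite eqEcard finset.subsetT cardsT D_card leqnn.
have : #|G| <= #|G| by [].
elim: {1 3}#|G| => [_|n IHn ltn].
  exists finset.set0, (fun=> 0), (fun=> 0); split; rewrite ?cards0 //.
    by move=> u v; rewrite inE.
  have no x : present finset.set0 x = false.
    by case: x => [v|e]; rewrite /= !inE ?andbF.
  split=> [x y|x y|e _|e _|e x _|e x _|e f _];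
    try by rewrite inE.
  - by move=> xP; move: (xP : present finset.set0 x); rewrite no.
  - by move=> xP; move: (xP : present finset.set0 x); rewrite no.
have [D [L [R [Dn Dlow inv]]]] := IHn (ltnW ltn).
have [w0 w0D] : exists w0, w0 \notin D.
  apply/existsP; rewrite -negb_forall; apply: contraTN ltn => /forallP allD.
  rewrite -leqNgt -Dn; apply: subset_leq_card; apply/fintype.subsetP => x _.
  exact: allD.
pose w := [arg min_(v < w0 | v \notin D) height v]%O.
have [wD wmin] : w \notin D /\ forall v, v \notin D -> (height w <= height v)%R.
  by rewrite /w; case: arg_minP => // v vD vmin; split.
have [L' [R' inv']] := sweep_step inv wD (fun u uD => Dlow u w uD wD) wmin.
exists (w |: D), L', R'; split=> //; first by rewrite cardsU1 wD Dn.
move=> u v; rewrite !inE negb_or => uD /andP[_ vD].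
by case/orP: uD => [/eqP->|uD]; [exact: wmin|exact: Dlow].
Qed.

End SweepDrawing.

(** * Levels and spines *)

Section Levels.
Variables (G : dag) (lft : G * G -> G * G -> Prop) (L R : G + G * G -> nat).
Hypothesis inv : swept lft [set: G]%SET L R.
Local Open Scope nat_scope.
Implicit Types (u v x y z : G) (e f : G * G) (A : {set G}).

Local Notation vbelow u v := (below L R (inl u) (inl v)).
Local Notation vbeloweq u v := (beloweq L R (inl u) (inl v)).
Local Notation vleft u v := (leftof L R (inl u) (inl v)).

Lemma vertex_cmp u v :
  u != v -> [|| vbelow u v, vbelow v u, vleft u v | vleft v u].
Proof.
have pv x : present [set: G]%SET (inl x) by rewrite /= inE.
move=> uv; have uvL : L (inl u) <> L (inl v).
  by move/(swept_injL inv)=> /(_ (pv _) (pv _))[] /eqP; exact/negP.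
have uvR : R (inl u) <> R (inl v).
  by move/(swept_injR inv)=> /(_ (pv _) (pv _))[] /eqP; exact/negP.
by rewrite /below /leftof; lia.
Qed.

Lemma beloweq_eq u v : vbeloweq u v -> vbeloweq v u -> u = v.
Proof.
move=> uv vu; apply/eqP; apply: contraT => /vertex_cmp.
by move: uv vu; rewrite /below /leftof /beloweq; lia.
Qed.

Lemma edge_tail e : e \in edges G -> below L R (inl e.1) (inr e).
Proof. by move=> eE; apply: (swept_tail inv) => //; rewrite inE. Qed.

Lemma edge_head e : e \in edges G -> below L R (inr e) (inl e.2).
Proof. by move=> eE; apply: (swept_head inv) => //; rewrite inE. Qed.

Lemma edge_below e : e \in edges G -> vbelow e.1 e.2.
Proof.
move=> eE; have := edge_tail eE; have := edge_head eE; rewrite /below; lia.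
Qed.

(** The form in which planarity is used: what is above an edge is above or equal to its head, what
    is below it is below or equal to its tail, and otherwise the two rankings disagree. *)
Lemma edge_vertex_cmp e x : e \in edges G ->
  [|| vbeloweq e.2 x, vbeloweq x e.1, leftof L R (inr e) (inl x)
    | leftof L R (inl x) (inr e)].
Proof.
move=> eE; have pe : present [set: G]%SET (inr e) by rewrite /= eE inE.
have px : present [set: G]%SET (inl x) by rewrite /= inE.
have e1 : e.1 \in [set: G]%SET by rewrite inE.
have exL : L (inr e) <> L (inl x) by move/(swept_injL inv)=> /(_ pe px).
have exR : R (inr e) <> R (inl x) by move/(swept_injR inv)=> /(_ pe px).
have [ex|nex] := boolP (below L R (inr e) (inl x)).
  by have [_ ->] := swept_above inv eE e1 px ex.
have [xe|nxe] := boolP (below L R (inl x) (inr e)).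
  by rewrite (swept_below inv eE e1 px xe) ?orbT.
by move: nex nxe; rewrite /below /leftof; lia.
Qed.

(** If [e] is below [f], then [swept_above] puts the head of [e] below [f], and [swept_below] then
    puts it below or at the tail of [f]. *)
Lemma edge_edge_cmp e f : e \in edges G -> f \in edges G -> e != f ->
  [|| vbeloweq e.2 f.1, vbeloweq f.2 e.1, leftof L R (inr e) (inr f)
    | leftof L R (inr f) (inr e)].
Proof.
move=> eE fE ef.
have pe : present [set: G]%SET (inr e) by rewrite /= eE inE.
have pf : present [set: G]%SET (inr f) by rewrite /= fE inE.
have efL : L (inr e) <> L (inr f).
  by move/(swept_injL inv)=> /(_ pe pf)[] /eqP; exact/negP.
have efR : R (inr e) <> R (inr f).
  by move/(swept_injR inv)=> /(_ pe pf)[] /eqP; exact/negP.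
have above e' f' : e' \in edges G -> f' \in edges G ->
    below L R (inr e') (inr f') -> vbeloweq e'.2 f'.1.
  move=> e'E f'E lt_ef; have pf' : present [set: G]%SET (inr f') by rewrite /= f'E inE.
  have p2 : present [set: G]%SET (inl e'.2) by rewrite /= inE.
  have e1 : e'.1 \in [set: G]%SET by rewrite inE.
  have f1 : f'.1 \in [set: G]%SET by rewrite inE.
  have [_ le2] := swept_above inv e'E e1 pf' lt_ef.
  have nL : L (inl e'.2) <> L (inr f') by move/(swept_injL inv)=> /(_ p2 pf').
  have nR : R (inl e'.2) <> R (inr f') by move/(swept_injR inv)=> /(_ p2 pf').
  apply: (swept_below inv f'E f1 p2); case/andP: le2 => l2 r2.
  by rewrite /below !ltn_neqAle l2 r2 !andbT; apply/andP; split; exact/eqP.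
have [/above ->|nef] := boolP (below L R (inr e) (inr f)); rewrite ?orbT //.
have [/above ->|nfe] := boolP (below L R (inr f) (inr e)); rewrite ?orbT //.
by move: nef nfe; rewrite /below /leftof; lia.
Qed.

(** Otherwise [x] would be comparable to both ends of [e], or [p] would be left of its own edge. *)
Lemma edge_left_of e p x : e \in edges G -> p = e.1 \/ p = e.2 ->
  vleft p x -> leftof L R (inr e) (inl x).
Proof.
move=> eE; have := edge_tail eE; have := edge_head eE.
have := edge_vertex_cmp x eE; rewrite /below /leftof /beloweq.
by move=> h1 h2 h3 [] ->; lia.
Qed.

Lemma edge_right_of e p x : e \in edges G -> p = e.1 \/ p = e.2 ->
  vleft x p -> leftof L R (inl x) (inr e).
Proof.
move=> eE; have := edge_tail eE; have := edge_head eE.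
have := edge_vertex_cmp x eE; rewrite /below /leftof /beloweq.
by move=> h1 h2 h3 [] ->; lia.
Qed.

Lemma preceq_beloweq u v : preceq u v -> vbeloweq u v.
Proof.
have conn : connect (edge G) u v -> vbeloweq u v.
  case/connectP=> p; elim: p u => [|a p IH] u /=.
    by move=> _ ->; rewrite /beloweq !leqnn.
  move=> /andP[ua /IH ap] /ap; have uaE : (u, a) \in edges G by rewrite inE.
  by have := edge_below uaE; rewrite /below /beloweq /=; lia.
by case/orP=> [/andP[_ /conn]|/eqP ->] //; rewrite /beloweq !leqnn.
Qed.

Lemma vleft_incomparable u v : vleft u v || vleft v u -> incomparable u v.
Proof.
move=> uv; apply/negP => /orP[] /preceq_beloweq; move: uv;
  rewrite /leftof /beloweq; lia.
Qed.

Definition left_chain v A :=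
  [forall x in A, vleft x v] &&
  [forall x in A, forall y in A, (x != y) ==> (vleft x y || vleft y x)].

(** The height of [v] in the strict partial order [vleft], counted from 0. *)
Definition level v := \max_(A | left_chain v A) #|A|.

Lemma left_chainP v A : reflect
  ({in A, forall x, vleft x v} /\
   {in A &, forall x y, x != y -> vleft x y || vleft y x}) (left_chain v A).
Proof.
apply: (iffP andP) => [[/forall_inP h /forall_inP h'] | [h h']]; split=> //.
- by move=> x y xA yA; exact: (implyP (forall_inP (h' _ xA) _ yA)).
- exact/forall_inP.
- by apply/forall_inP => x xA; apply/forall_inP => y yA; apply/implyP; exact: h'.
Qed.

Lemma level_chain v : exists2 A, left_chain v A & #|A| = level v.
Proof.
have c0 : left_chain v finset.set0.
  by apply/left_chainP; split=> [x|x y]; rewrite inE.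
rewrite /level (bigop.bigmax_eq_arg _ c0).
by case: arg_maxnP => // A; exists A.
Qed.

Lemma level_max v A : left_chain v A -> #|A| <= level v.
Proof. by move=> cA; apply: (leq_bigmax_cond (F := fun A => #|A|)). Qed.

Lemma left_chainU u v A : vleft u v -> left_chain u A -> left_chain v (u |: A)%SET.
Proof.
move=> uv /left_chainP[Au AA]; apply/left_chainP; split.
  by move=> x; rewrite !inE => /orP[/eqP->|/Au] //; move: uv; rewrite /leftof; lia.
move=> x y; rewrite !inE => /orP[/eqP->|xA] /orP[/eqP->|yA] xy.
- by rewrite eqxx in xy.
- by rewrite Au ?orbT.
- by rewrite Au.
- exact: AA.
Qed.

Lemma left_chain_notin u A : left_chain u A -> u \notin A.
Proof.
by move=> /left_chainP[Au _]; apply/negP => /Au; rewrite /leftof ltnn.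
Qed.

Lemma level_lt u v : vleft u v -> level u < level v.
Proof.
move=> uv; have [A cA <-] := level_chain u.
have := level_max (left_chainU uv cA).
by rewrite cardsU1 left_chain_notin.
Qed.

(** The rightmost vertex [u] of a longest chain works: the rest of the chain lies left of [u]. *)
Lemma level_pred v : 0 < level v -> exists2 u, vleft u v & level v <= (level u).+1.
Proof.
have [A cA <-] := level_chain v; rewrite card_gt0 => /set0Pn[u0 u0A].
have /left_chainP[Av AA] := cA.
pose u := [arg max_(x > u0 in A) L (inl x)].
have [uA umax] : u \in A /\ {in A, forall x, L (inl x) <= L (inl u)}.
  by rewrite /u; case: arg_maxnP.
exists u; first exact: Av.
rewrite (cardsD1 u) uA ltnS; apply: level_max; apply/left_chainP; split.
  move=> x; rewrite !inE => /andP[xu xA]; have := umax _ xA.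
  by case/orP: (AA _ _ xA uA xu) => //; rewrite /leftof; lia.
by move=> x y; rewrite !inE => /andP[_ xA] /andP[_ yA]; exact: AA.
Qed.

(** A chain of [vleft], together with [v], is an antichain for reachability. *)
Lemma level_width v : level v < width G.
Proof.
have [A cA <-] := level_chain v.
have -> : #|A|.+1 = #|v |: A|%SET by rewrite cardsU1 left_chain_notin.
apply: (leq_bigmax_cond (F := fun A : {set G} => #|A|)).
have /left_chainP[Av AA] := cA.
apply/forall_inP => x xA; apply/forall_inP => y yA; apply/implyP => xy.
apply: vleft_incomparable; move: xA yA xy; rewrite !inE.
move=> /orP[/eqP->|xA] /orP[/eqP->|yA] xy.
- by rewrite eqxx in xy.
- by rewrite Av ?orbT.
- by rewrite Av.
- exact: AA.
Qed.

(* The [k]-th of [width G] noncrossing maximal chains covering [G]. *)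
Definition spine k v := (level v <= k) && [forall x, vleft v x ==> (k < level x)].

Lemma spineP k v :
  reflect (level v <= k /\ forall x, vleft v x -> k < level x) (spine k v).
Proof.
apply: (iffP andP) => -[h h']; split=> //.
  by move=> x; apply/implyP; move: x; exact/forallP.
by apply/forallP => x; apply/implyP; exact: h'.
Qed.

Lemma spine_level v : spine (level v) v.
Proof. by apply/spineP; split=> // x; exact: level_lt. Qed.

Lemma spine_chain k u v : spine k u -> spine k v -> u != v ->
  vbelow u v || vbelow v u.
Proof.
move=> /spineP[uk uP] /spineP[vk vP] /vertex_cmp /or4P[] => [->|->|/uP|/vP] //;
  rewrite ?orbT //; lia.
Qed.

(* [l] is the left end of [e], on some spine [i], and [r] its right end, on the
   spine [i.+1]; [e] may point either way. *)
Definition gap_edge e l r :=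
  [/\ e \in edges G, level l < level r, ~~ spine (level r) l &
      (l, r) = e \/ (r, l) = e].

(** The edge lies right of some [z'] of level at least [i], and left of some [x0] of level at most
    [i.+1]. A vertex of spine [i] right of [e] would be right of [z'], and one of spine [i.+1] left
    of [e] would be left of [x0]; the levels exclude both. *)
Lemma gap_edgeP e l r : gap_edge e l r -> exists i,
  [/\ level r = i.+1, spine i l, spine i.+1 r,
      forall z, spine i z ->
        [|| vbeloweq z e.1, vbeloweq e.2 z | leftof L R (inl z) (inr e)] &
      forall z, spine i.+1 z ->
        [|| vbeloweq z e.1, vbeloweq e.2 z | leftof L R (inr e) (inl z)]].
Proof.
case=> eE lr nl lre.
have eL x : vleft l x -> leftof L R (inr e) (inl x).
  by apply: (edge_left_of eE); case: lre => <-; [left|right].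
have eR x : vleft x r -> leftof L R (inl x) (inr e).
  by apply: (edge_right_of eE); case: lre => <-; [right|left].
have [x0 lx0 x0r] : exists2 x0, vleft l x0 & level x0 <= level r.
  move: nl; rewrite /spine (ltnW lr) /= negb_forall => /existsP[x].
  by rewrite negb_imply -leqNgt => /andP[]; exists x.
have [z' z'r lz'] := level_pred (leq_ltn_trans (leq0n _) lr).
exists (level r).-1; have rE : level r = (level r).-1.+1 by lia.
split=> //.
- apply/spineP; split; first lia.
  move=> x /eL ex; have := eR _ z'r => z'e.
  by have /level_lt : vleft z' x by [move: ex z'e; rewrite /leftof; lia]; lia.
- by rewrite -rE spine_level.
- move=> z /spineP[zi zP]; have := edge_vertex_cmp z eE.
  have /negPf-> : ~~ leftof L R (inr e) (inl z); last by case/or4P=> [->|->|//|->]; rewrite ?orbT.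
  apply/negP => ez; have := eR _ z'r => z'e.
  by have /level_lt : vleft z' z by [move: ez z'e; rewrite /leftof; lia]; lia.
- move=> z; rewrite -rE => /spineP[zi zP]; have := edge_vertex_cmp z eE.
  have /negPf-> : ~~ leftof L R (inl z) (inr e); last by case/or4P=> [->|->|->|//]; rewrite ?orbT.
  apply/negP => ze; have := eL _ lx0 => ex0.
  by have /zP : vleft z x0 by [move: ze ex0; rewrite /leftof; lia]; lia.
Qed.

End Levels.

(** * Linear extensions of conjugate orders *)

Section LinearExtension.
Variable T : finType.
Local Open Scope nat_scope.
Implicit Types (P Q : T -> nat) (a b x y z : T) (W : rel T).

Lemma order_rank (p : rel T) : irreflexive p -> transitive p ->
  (forall x y, x != y -> p x y || p y x) ->
  exists2 P : T -> nat, injective P & forall x y, (P x < P y) = p x y.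
Proof.
move=> irr tr tot; pose P x := #|[pred y | p y x]|.
have P_lt x y : p x y -> P x < P y.
  move=> xy; apply: proper_card; apply/fintype.properP; split.
    by apply/fintype.subsetP => z; rewrite !inE => /tr; apply.
  by exists x; rewrite !inE ?irr.
have PE x y : (P x < P y) = p x y.
  apply/idP/idP => [xy|/P_lt //]; have [E|/tot] := eqVneq x y.
    by rewrite E ltnn in xy.
  by case/orP=> // /P_lt yx; have := ltn_trans xy yx; rewrite ltnn.
exists P => // x y E; apply/eqP; apply: contraT => /tot.
by rewrite -!PE E ltnn.
Qed.

(* Neighbours [a], [b] in the conjugate order are made comparable, keeping both
   linear orders linear. *)
Lemma flip P Q a b : injective P -> injective Q ->
  P a < P b -> Q b < Q a ->
  (forall y, leftof P Q a y -> leftof P Q y b -> False) ->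
  exists P', [/\ injective P', P' b < P' a,
    forall x y, below P Q x y -> P' x < P' y &
    forall x y, P' x < P' y -> P x < P y \/
      (beloweq P Q x b /\ beloweq P Q a y)].
Proof.
move=> iP iQ ab ba adj.
(* The pairs forced by putting [b] before [a]. The new order [p] agrees with [P] except on forced
   pairs, all of which [Q] already respects. *)
pose N x y := beloweq P Q x b && beloweq P Q a y.
pose p x y := N x y || (~~ N y x && (P x < P y)).
have NQ x y : N x y -> Q x < Q y.
  by rewrite /N /beloweq => /andP[/andP[_ h1] /andP[_ h2]]; lia.
have PQ x y : P x = P y -> Q x = Q y by move/iP ->.
have QP x y : Q x = Q y -> P x = P y by move/iQ ->.
(* By adjacency, whatever [P] puts between [a] and [b] is below [b] or above [a]. The transitivity
   of [p] rests on this. *)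
have gap y : P a < P y -> P y < P b -> Q y <= Q b \/ Q a <= Q y.
  move=> h1 h2; have := adj y; rewrite /leftof h1 h2 /= => h.
  by have [|h3] := leqP (Q y) (Q b); [left|right; rewrite leqNgt; apply/negP=> h4; exact: h].
have [|y x z|x y|P' P'i P'E] := @order_rank p.
- move=> x; rewrite /p ltnn andbF orbF; apply/negP => /NQ; rewrite ltnn //.
- have ltP u v : P u <= P v -> Q u != Q v -> P u < P v.
    by move=> uv; rewrite ltn_neqAle uv andbT; apply: contraNneq => /PQ ->.
  have xab : N x y -> P y < P z -> ~~ N z y -> p x z.
    move=> /andP[xb ay] yz; rewrite {1}/N ay andbT => zb.
    have [Nxz|] := boolP (N x z); first by rewrite /p Nxz.
    rewrite {1}/N xb /= => az; suff bz : P b < P z.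
      rewrite /p; apply/orP; right; apply/andP; split.
        by rewrite /N /beloweq (leqNgt (P z)) bz.
      by case/andP: xb => xb _; exact: leq_ltn_trans bz.
    rewrite ltnNge; apply/negP => zPb.
    move: ay az zb; rewrite /beloweq zPb /= -ltnNge => /andP[ay _].
    have az : P a < P z by exact: leq_ltn_trans yz.
    rewrite (ltnW az) /= -!ltnNge => zQa bQz.
    by case: (gap z az (ltP _ _ zPb _)); lia.
  have abz : N y z -> P x < P y -> ~~ N y x -> p x z.
    move=> /andP[yb az] xy; rewrite {1}/N yb /= => ax.
    have [Nxz|] := boolP (N x z); first by rewrite /p Nxz.
    rewrite {1}/N az andbT => xb; suff xa : P x < P a.
      rewrite /p; apply/orP; right; apply/andP; split.
        by rewrite /N /beloweq (leqNgt (P a) (P x)) xa andbF.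
      by case/andP: az => az _; exact: leq_trans az.
    rewrite ltnNge; apply/negP => aPx.
    move: yb ax xb; rewrite /beloweq aPx /= -ltnNge => /andP[yb _].
    have xb : P x < P b by exact: leq_trans yb.
    rewrite (ltnW xb) /= -!ltnNge => xQa bQx.
    by case: (gap x (ltP _ _ aPx _) xb); lia.
  rewrite {1 2}/p => /orP[xy|/andP[yx xy]] /orP[yz|/andP[zy yz]].
  + by move: xy yz; rewrite /N /beloweq => /andP[_ ?] /andP[? _]; lia.
  + exact: xab.
  + exact: abz.
  + rewrite /p (ltn_trans xy yz) andbT; apply/orP; right.
    apply/negP => /andP[/andP[zPb zQb] /andP[aPx aQx]].
    have ay : P a < P y by exact: leq_ltn_trans xy.
    have yb : P y < P b by exact: leq_trans zPb.
    move: yx zy; rewrite /N /beloweq zPb zQb aPx aQx (ltnW ay) (ltnW yb) andbT /=.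
    by case: (gap y ay yb) => ->.
- rewrite /p => xy; have : P x != P y by apply: contraNneq xy => /iP ->.
  by case: (N x y); case: (N y x) => //=; rewrite neq_ltn.
exists P'; split=> //.
- by rewrite P'E /p /N /beloweq !leqnn.
- move=> x y /andP[xP xQ]; rewrite P'E /p xP andbT.
  by case: (boolP (N y x)) => [/NQ|]; rewrite ?orbT //; lia.
- by move=> x y; rewrite P'E => /orP[/andP[]|/andP[]]; [right|left].
Qed.

Definition adjacent P Q a b :=
  leftof P Q a b /\ (forall y, leftof P Q a y -> leftof P Q y b -> False).

(* [W b a] is the request that [b] precede [a]. *)
Record consistent P Q W : Prop := Consistent {
  consistent_injl : injective P;
  consistent_injr : injective Q;
  consistent_adj : forall b a, W b a -> adjacent P Q a b \/ adjacent P Q b a;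
  consistent_noconf : forall b1 a1 b2 a2, W b1 a1 -> W b2 a2 ->
    beloweq P Q a1 b2 -> beloweq P Q a2 b1 -> False
}.

Lemma consistentC P Q W : consistent P Q W -> consistent Q P W.
Proof.
move=> [iP iQ adj noconf].
have leftC x y : leftof Q P x y = leftof P Q y x by rewrite /leftof andbC.
have adjC a b : adjacent P Q a b -> adjacent Q P b a.
  by move=> [ab h]; split=> [|y]; rewrite !leftC // => ya by_; exact: h by_ ya.
split=> // [b a /adj[]/adjC|b1 a1 b2 a2 w1 w2]; [by right|by left|].
by move=> h1 h2; apply: (noconf _ _ _ _ w1 w2); rewrite /beloweq andbC.
Qed.

(** A flip only shrinks [leftof], so a request still pending keeps its adjacency, provided that its
    two vertices are not made comparable the wrong way; that would be a conflict with the request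
    granted. *)
Lemma consistent_flip P Q W b a : consistent P Q W -> W b a ->
  adjacent P Q a b -> exists P',
  [/\ forall x y, below P Q x y -> below P' Q x y, below P' Q b a &
      consistent P' Q (fun y x => W y x && ~~ below P' Q y x)].
Proof.
move=> [iP iQ adj noconf] wba [/andP[ab ba] noy].
have [P' [iP' ba' sub sup]] := flip iP iQ ab ba noy.
have left_sub x y : leftof P' Q x y -> leftof P Q x y.
  move=> /andP[/sup[xy|[/andP[_ h1] /andP[_ h2]]] yx]; first exact/andP.
  by lia.
have adj' b1 a1 : W b1 a1 && ~~ below P' Q b1 a1 ->
    adjacent P' Q a1 b1 \/ adjacent P' Q b1 a1.
  move=> /andP[w1 nb]; have PE : P' a1 = P' b1 -> P a1 = P b1 by move/iP' ->.
  case: (adj _ _ w1) => -[/andP[h1 h2] h]; [left|right];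
    (split; last by move=> y /left_sub l /left_sub; exact: h).
    by move: nb; rewrite /below /leftof h2 andbT; lia.
  apply/andP; split=> //; rewrite ltnNge; apply/negP => ab1.
  have [|h3|[h3 h4]] := sup a1 b1; [by lia|by lia|].
  exact: (noconf _ _ _ _ wba w1 h4 h3).
exists P'; split=> [x y xy||].
- by rewrite /below (sub _ _ xy); case/andP: xy.
- by rewrite /below ba'.
split=> // b1 a1 b2 a2 w1 w2 ab12 ab21.
have PE x y : P x <> P y -> Q x <> Q y by move=> nP /iQ E; rewrite E in nP.
(* Conflicting requests point in opposite directions, since otherwise one of the rankings would have
   a cycle. *)
wlog l1 : b1 a1 b2 a2 w1 w2 ab12 ab21 / leftof P' Q a1 b1.
  move=> th; case: (adj' _ _ w1) => -[l1 _]; first exact: (th b1 a1 b2 a2).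
  case: (adj' _ _ w2) => -[l2 _]; first exact: (th b2 a2 b1 a1).
  by move: l1 l2 ab12 ab21; rewrite /leftof /beloweq; lia.
have [w1' w2'] : W b1 a1 /\ W b2 a2 by case/andP: w1; case/andP: w2.
have l2 : leftof P' Q b2 a2.
  case: (adj' _ _ w2) => -[//]; move: l1 ab12 ab21; rewrite /leftof /beloweq; lia.
have /left_sub la : leftof P' Q a1 a2.
  by move: l1 l2 ab12 ab21; rewrite /leftof /beloweq; lia.
have /left_sub lb : leftof P' Q b2 b1.
  by move: l1 l2 ab12 ab21; rewrite /leftof /beloweq; lia.
have /left_sub {}l2 := l2.
have noy2 y : leftof P Q b2 y -> leftof P Q y a2 -> False.
  case: (adj _ _ w2') => -[l' h]; last exact: h.
  by move: l2 l'; rewrite /leftof; lia.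
case/andP: ab12 => _ q12; case/andP: ab21 => _ q21.
(* The conflict was already there before the flip: otherwise [a1] or [b1] would have been strictly
   between the adjacent [b2] and [a2]. *)
apply: (noconf _ _ _ _ w1' w2'); rewrite /beloweq ?q12 ?q21 andbT leqNgt;
  apply/negP => lt.
- apply: (noy2 a1) => //; rewrite /leftof lt ltn_neqAle q12 andbT.
  by apply/eqP; apply: PE; lia.
- apply: (noy2 b1) => //; rewrite /leftof lt ltn_neqAle q21 andbT.
  by apply/eqP; apply: PE; lia.
Qed.

(** Each flip grants a request, so their number decreases; once none is pending, [P] itself serves.
    Exchanging [P] and [Q] reverses [leftof], so it suffices to flip in one direction. *)
Lemma linear_extension P Q W : consistent P Q W ->
  exists S : T -> nat, [/\ injective S,
    forall x y, below P Q x y -> S x < S y & forall b a, W b a -> S b < S a].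
Proof.
have [n] := ubnP #|[pred p : T * T | W p.1 p.2]|.
elim: n P Q W => // n IH P Q W Wn cW.
have [[b a] /= wba|noW] := pickP [pred p : T * T | W p.1 p.2]; last first.
  exists P; split=> [|x y /andP[]|b a wba] //; first exact: consistent_injl cW.
  by have := noW (b, a); rewrite /= wba.
wlog adj : P Q cW / adjacent P Q a b.
  move=> th; case: (consistent_adj cW wba) => [|adj]; first exact: th.
  have [||S [iS subS WS]] := th Q P; first exact: consistentC.
    case: adj => ba noy; split=> [|y ay yb]; first by move: ba; rewrite /leftof andbC.
    by apply: (noy y); [move: yb|move: ay]; rewrite /leftof andbC.
  by exists S; split=> // x y xy; apply: subS; move: xy; rewrite /below andbC.
have [P' [sub ba' cW']] := consistent_flip cW wba adj.
have [|S [iS subS WS]] := IH _ _ _ _ cW'.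
  rewrite -ltnS; apply: leq_trans Wn; rewrite ltnS; apply: proper_card.
  apply/fintype.properP; split.
    by apply/fintype.subsetP => p; rewrite !inE => /andP[].
  by exists (b, a); rewrite !inE /= ?ba' ?andbF.
exists S; split=> // [x y /sub/subS //|y x w].
by have [/subS //|nb] := boolP (below P' Q y x); apply: WS; rewrite w.
Qed.

End LinearExtension.

(** * Pages *)

Section Pages.
Variables (G : dag) (lft : G * G -> G * G -> Prop) (L R : G + G * G -> nat).
Hypothesis inv : swept lft [set: G]%SET L R.
Local Open Scope nat_scope.
Implicit Types (u v x y z p q : G) (e f : G * G).

Local Notation vbelow u v := (below L R (inl u) (inl v)).
Local Notation vbeloweq u v := (beloweq L R (inl u) (inl v)).
Local Notation vleft u v := (leftof L R (inl u) (inl v)).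
Local Notation level := (level L R).
Local Notation spine := (spine L R).

Definition right_going e :=
  [&& e \in edges G, level e.1 < level e.2 & ~~ spine (level e.2) e.1].
Definition left_going e :=
  [&& e \in edges G, level e.2 < level e.1 & ~~ spine (level e.1) e.2].

Lemma right_going_gap e : right_going e -> gap_edge L R e e.1 e.2.
Proof. by case/and3P=> *; split=> //; left; case: (e). Qed.

Lemma left_going_gap e : left_going e -> gap_edge L R e e.2 e.1.
Proof. by case/and3P=> *; split=> //; right; case: (e). Qed.

(** By [gap_edgeP] the tail's spine has index [(level q).-1] for a right-going edge and [level p]
    for a left-going one. A vertex of it incomparable to [q] can only lie on the tail's side. *)
Definition requests q x : bool :=
  [exists p, [&& right_going (p, q), spine (level q).-1 x, vbelow p x & vleft x q]] ||
  [exists p, [&& left_going (p, q), spine (level p) x, vbelow p x & vleft q x]].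

(** Here [x] is left of [y] and [f.2] left of [e.2], so by their levels both edges lie in one gap.
    There [f] is left of [e], although [e] starts on the left spine and [f] on the right one. This
    forces equal tails and puts [e.1] on both spines. *)
Lemma right_left_conflict e x f y :
  right_going e -> spine (level e.2).-1 x -> vbelow e.1 x -> vleft x e.2 ->
  left_going f -> spine (level f.1) y -> vbelow f.1 y -> vleft f.2 y ->
  vbeloweq x f.2 -> vbeloweq y e.2 -> False.
Proof.
move=> re sx ex xe lf sy fy yf xf ye.
have [eE _ ne _] := right_going_gap re; have [fE _ _ _] := left_going_gap lf.
have [i [lei se1 se2 e_i e_i1]] := gap_edgeP inv (right_going_gap re).
have [j [lfj sf2 sf1 f_j f_j1]] := gap_edgeP inv (left_going_gap lf).
rewrite lei /= in sx; rewrite lfj in sy.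
have xy : vleft x y.
  have xy : x != y.
    by apply: contraTneq xe => ->; move: ye; ranks.
  have := vertex_cmp inv xy; move: xe ye yf xf.
  by ranks.
have fe : vleft f.2 e.2 by move: xe ye yf xf; ranks.
have ij : i = j.
  have /spineP[_ h1] := sx; have /spineP[h2 _] := sy.
  have /spineP[_ h3] := sf2; have /spineP[h4 _] := se2.
  by have := h1 _ xy; have := h3 _ fe; move: h2 h4; clear; lia.
subst j.
have e_f2 : leftof L R (inl f.2) (inr e).
  by have := e_i _ sf2; move: ex xf fe; ranks.
have f_e2 : leftof L R (inr f) (inl e.2).
  by have := f_j1 _ se2; move: fy ye fe; ranks.
have ef : e != f.
  by apply: contraTneq e_f2 => ->; have := edge_head inv fE; ranks.
have fle : leftof L R (inr f) (inr e).
  have := edge_edge_cmp inv eE fE ef; have := edge_head inv fE.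
  by move: e_f2 ex xf fy ye; ranks.
have ef1 : vbeloweq e.1 f.1.
  have := f_j _ se1; have := edge_tail inv eE; move: ex xf fle.
  by ranks.
have fe1 : vbeloweq f.1 e.1.
  have := e_i1 _ sf1; have := edge_tail inv fE; move: fy ye fle.
  by ranks.
by move: ne; rewrite lei (beloweq_eq inv ef1 fe1) sf1.
Qed.

(** Levels increase from left to right and leave no room between the two vertices of a request. Two
    requests of the same direction cannot conflict, since one ranking would have a cycle. *)
Lemma requests_consistent :
  consistent (fun v => L (inl v)) (fun v => R (inl v)) requests.
Proof.
have pv x : present [set: G]%SET (inl x) by rewrite /= inE.
split=> [x y|x y|q x|q1 x1 q2 x2].
- by move/(swept_injL inv)=> /(_ (pv _) (pv _))[].
- by move/(swept_injR inv)=> /(_ (pv _) (pv _))[].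
- case/orP=> /existsP[p /and4P[g sx px xq]]; [left|right]; split=> // y h1 h2.
    have /and3P[_ /= lpq _] := g; have /spineP[_ /(_ y h1)] := sx.
    by have := level_lt h2; move: lpq; clear; lia.
  have [i [lpi /spineP[_ sq] _ _ _]] := gap_edgeP inv (left_going_gap g).
  have /spineP[sx1 _] := sx; rewrite /= in lpi.
  by have := sq _ h1; have := level_lt h2; move: lpi sx1; clear; lia.
case/orP=> /existsP[p1 /and4P[g1 sx1 px1 xq1]];
  case/orP=> /existsP[p2 /and4P[g2 sx2 px2 xq2]] h12 h21.
- by move: h12 h21 xq1 xq2; ranks.
- exact: (right_left_conflict g1 sx1 px1 xq1 g2 sx2 px2 xq2 h12 h21).
- exact: (right_left_conflict g2 sx2 px2 xq2 g1 sx1 px1 xq1 h21 h12).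
- by move: h12 h21 xq1 xq2; ranks.
Qed.

(** For an edge [e], this means by [edge_vertex_cmp] that [x] is left or right of [e]. *)
Definition between x e := ~~ vbeloweq x e.1 && ~~ vbeloweq e.2 x.

(** * Two pages for the edges from one chain to another *)

Section Parity.
Variables (C : pred (G * G)) (A B : pred G) (S : G -> nat).
Hypothesis CA : forall e, C e -> A e.1.
Hypothesis CB : forall e, C e -> B e.2.
Hypothesis A_chain : forall x y, A x -> A y -> x != y -> vbelow x y || vbelow y x.
Hypothesis B_chain : forall x y, B x -> B y -> x != y -> vbelow x y || vbelow y x.
Hypothesis sep : forall e x y, C e -> A x -> B y -> between x e -> between y e ->
  ~ vbelow x y.
Hypothesis S_below : forall x y, vbelow x y -> S x < S y.
Hypothesis S_request : forall e f, C e -> C f -> vbelow e.1 f.1 ->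
  vbelow f.1 e.2 \/ S e.2 <= S f.1.

(** The tails of the later-starting edges of crossing pairs. The parity of the number of these up to
    an edge's tail tells the two pages apart. *)
Definition crossed x := [exists e, exists f,
  [&& C e, C f, f.1 == x, vbelow e.1 x, vbelow x e.2 & vbelow e.2 f.2]].

Definition parity e := odd #|[pred z | crossed z && vbeloweq z e.1]|.

(* If [e] and [f] cross, then [f.1] is the last vertex of [A] below [e.2], and no
   crossed vertex lies strictly between [e.1] and [f.1]. *)
Lemma crossing_parity e f : C e -> C f ->
  S e.1 < S f.1 -> S f.1 < S e.2 -> S e.2 < S f.2 -> parity f = ~~ parity e.
Proof.
move=> eC fC ef1 fe2 ef2.
have chain (D : pred G) x y : (forall x y, D x -> D y -> x != y -> vbelow x y || vbelow y x) ->
    D x -> D y -> S x < S y -> vbelow x y.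
  move=> D_chain xD yD xy; have nxy : x != y by apply: contraTneq xy => ->; rewrite ltnn.
  by case/orP: (D_chain _ _ xD yD nxy) => // /S_below; move: xy; clear; lia.
have {}ef1 := chain _ _ _ A_chain (CA eC) (CA fC) ef1.
have {}ef2 := chain _ _ _ B_chain (CB eC) (CB fC) ef2.
(* The requests turn this comparison between different chains into one valid in both rankings. *)
have {}fe2 : vbelow f.1 e.2 by case: (S_request eC fC ef1) => //; move: fe2; clear; lia.
rewrite /parity (cardD1 f.1) inE /=.
have -> : crossed f.1.
  by apply/existsP; exists e; apply/existsP; exists f; rewrite eC fC eqxx ef1 fe2.
rewrite {1}/beloweq !leqnn oddS /=; congr (~~ odd _); apply: eq_card => z.
rewrite !inE; apply/idP/idP; last first.
  case/andP=> -> ze /=; apply/andP; split.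
    by apply: contraTneq ze => ->; move: ef1; ranks.
  by move: ze ef1; ranks.
case/and3P=> zf1 zc zlef; rewrite zc /=; apply: contraT => nze.
(* Let [z], strictly between [e.1] and [f.1], be the tail of [h] crossing [g]. As [z] is below
   [g.2], the edge [e] cannot separate them, so [e.2] is at most [g.2]. Then [f.1] is below [g.2],
   although [h] separates these two. *)
have /existsP[g /existsP[h /and5P[gC hC /eqP hz gz /andP[zg gh]]]] := zc.
have zA : A z by rewrite -hz CA.
have zf : vbelow z f.1.
  by have := A_chain zA (CA fC) zf1; move: zlef; ranks.
have ze : between z e.
  by rewrite /between nze; move: zf fe2; ranks.
have ge : ~~ between g.2 e.
  by apply/negP => ge; exact: (sep eC zA (CB gC) ze ge).
have leg : vbeloweq e.2 g.2.
  move: ge nze zg; rewrite /between negb_and !negbK; ranks.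
exfalso; apply: (sep hC (CA fC) (CB gC)).
- by rewrite /between hz; move: zf fe2 leg gh; ranks.
- by rewrite /between hz; move: zg gh; ranks.
- by move: fe2 leg; ranks.
Qed.

End Parity.

(** * Chords of a spine *)

Definition chord_level e := maxn (level e.1) (level e.2).

(** A chord with no vertex of its spine beside it counts as passing on the left. *)
Definition chord_right e :=
  [exists z, [&& spine (chord_level e) z, between z e & leftof L R (inl z) (inr e)]].

Lemma chord_ends e : e \in edges G -> ~~ right_going e -> ~~ left_going e ->
  spine (chord_level e) e.1 /\ spine (chord_level e) e.2.
Proof.
rewrite /right_going /left_going /chord_level => -> /=.
case: ltngtP => [h|h|E] /=; rewrite ?negbK ?E.
- by move=> h1 _; rewrite spine_level.
- by move=> _ h1; rewrite spine_level.
- by move=> _ _; rewrite -{1}E !spine_level.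
Qed.

(** Vertices on both sides of [e] would be related by [vleft], but a spine is a chain for
    [below]. *)
Lemma chord_side e z : e \in edges G -> spine (chord_level e) z -> between z e ->
  if chord_right e then leftof L R (inl z) (inr e) else leftof L R (inr e) (inl z).
Proof.
move=> eE sz ze; have := edge_vertex_cmp inv z eE; move: (ze).
rewrite {1}/between => /andP[/negPf-> /negPf->] /=.
case: ifP => [/existsP[y /and3P[sy _ yle]]|/existsPn/(_ z)]; last first.
  by rewrite sz ze /= => /negPf->; rewrite orbF.
case/orP=> // elz; have yz : vleft y z by move: yle elz; ranks.
have nyz : y != z by apply: contraTneq yz => ->; ranks.
by have := spine_chain inv sy sz nyz; move: yz; ranks.
Qed.

Section Crossing.
Variable S : G -> nat.
Hypothesis S_below : forall x y, vbelow x y -> S x < S y.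
Hypothesis S_request : forall q x, requests q x -> S q < S x.

Lemma spine_below k x y : spine k x -> spine k y -> S x < S y -> vbelow x y.
Proof.
move=> sx sy xy; have nxy : x != y by apply: contraTneq xy => ->; rewrite ltnn.
by case/orP: (spine_chain inv sx sy nxy) => // /S_below; move: xy; clear; lia.
Qed.

(** The spine vertices [f.1] beside [e] and [e.2] beside [f] lie on the same side of these chords.
    Whichever chord is further left, some edge would then be beside its own end. *)
Lemma chord_crossing e f : e \in edges G -> f \in edges G ->
  ~~ right_going e -> ~~ left_going e -> ~~ right_going f -> ~~ left_going f ->
  chord_level e = chord_level f -> chord_right e = chord_right f ->
  S e.1 < S f.1 -> S f.1 < S e.2 -> S e.2 < S f.2 -> False.
Proof.
move=> eE fE re le rf lf kef sef ef1 fe2 ef2.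
have [e1 e2] := chord_ends eE re le; have [f1 f2] := chord_ends fE rf lf.
move: (f1) (f2); rewrite -kef => f1' f2'.
have {}ef1 := spine_below e1 f1' ef1; have {}fe2 := spine_below f1' e2 fe2.
have {}ef2 := spine_below e2 f2' ef2.
have := chord_side eE f1'; rewrite {1}/between.
have -> : ~~ vbeloweq f.1 e.1 by move: ef1; ranks.
have -> : ~~ vbeloweq e.2 f.1 by move: fe2; ranks.
rewrite kef in e2.
have := chord_side fE e2; rewrite {1}/between -sef.
have -> : ~~ vbeloweq e.2 f.1 by move: fe2; ranks.
have -> : ~~ vbeloweq f.2 e.2 by move: ef2; ranks.
move=> /(_ isT) h1 /(_ isT) h2.
have ef : e != f by apply: contraTneq ef1 => ->; ranks.
have := edge_edge_cmp inv eE fE ef.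
have := edge_tail inv fE; have := edge_head inv eE.
by move: ef1 fe2 ef2 h1 h2; case: (chord_right e); ranks.
Qed.

Definition right_class m := [pred e | right_going e && (level e.2 == m)].
Definition left_class m := [pred e | left_going e && (level e.1 == m)].

(** This is [crossing_parity] with tails on spine [m.-1] and heads on spine [m]; each edge of the
    class separates the vertices of the two spines beside it. *)
Lemma right_crossing m e f : right_class m e -> right_class m f ->
  S e.1 < S f.1 -> S f.1 < S e.2 -> S e.2 < S f.2 ->
  parity (right_class m) f = ~~ parity (right_class m) e.
Proof.
have gapP g : right_class m g -> exists i,
    [/\ m = i.+1, spine i g.1, spine m g.2,
      forall z, spine i z ->
        [|| vbeloweq z g.1, vbeloweq g.2 z | leftof L R (inl z) (inr g)] &
      forall z, spine m z ->
        [|| vbeloweq z g.1, vbeloweq g.2 z | leftof L R (inr g) (inl z)]].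
  move=> /andP[rg /eqP gm]; have := gap_edgeP inv (right_going_gap rg).
  by rewrite gm => -[i [E]]; rewrite -E; exists i; split.
apply: (crossing_parity (A := spine m.-1) (B := spine m)) => //.
- by move=> g /gapP[i [-> sg _ _ _]].
- by move=> g /gapP[i []].
- by move=> x y; exact: (spine_chain inv).
- by move=> x y; exact: (spine_chain inv).
- move=> g x y /gapP[i [-> _ _ gi gi1]] /gi + /gi1 +.
  by rewrite /between; ranks.
- move=> g h gC hC gh1.
  have [i [mi _ _ _ _]] := gapP _ gC; have [j [mj sh _ _ _]] := gapP _ hC.
  have [->|nhg] := eqVneq h.1 g.2; first by right.
  case/or4P: (vertex_cmp inv nhg) => [->|/S_below/ltnW|hg|/level_lt gh].
  + by left.
  + by right.
  (* Here [h.1] follows [g.1] on its spine and is incomparable to [g.2], so the edge [g] requests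
     that [g.2] come first. *)
  + right; apply/ltnW/S_request/orP; left; apply/existsP; exists g.1.
    have /andP[rg /eqP ->] := gC.
    by rewrite -surjective_pairing rg gh1 hg mj sh.
  + have /spineP[hj _] := sh; have /andP[_ /eqP gm] := gC.
    by move: gh hj; rewrite gm mj; clear; lia.
Qed.

Lemma left_crossing m e f : left_class m e -> left_class m f ->
  S e.1 < S f.1 -> S f.1 < S e.2 -> S e.2 < S f.2 ->
  parity (left_class m) f = ~~ parity (left_class m) e.
Proof.
have gapP g : left_class m g -> exists i,
    [/\ m = i.+1, spine i g.2, spine m g.1,
      forall z, spine i z ->
        [|| vbeloweq z g.1, vbeloweq g.2 z | leftof L R (inl z) (inr g)] &
      forall z, spine m z ->
        [|| vbeloweq z g.1, vbeloweq g.2 z | leftof L R (inr g) (inl z)]].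
  move=> /andP[rg /eqP gm]; have := gap_edgeP inv (left_going_gap rg).
  by rewrite gm => -[i [E]]; rewrite -E; exists i; split.
apply: (crossing_parity (A := spine m) (B := spine m.-1)) => //.
- by move=> g /gapP[i []].
- by move=> g /gapP[i [-> sg _ _ _]].
- by move=> x y; exact: (spine_chain inv).
- by move=> x y; exact: (spine_chain inv).
- move=> g x y /gapP[i [-> _ _ gi gi1]] /gi1 + /gi +.
  by rewrite /between; ranks.
- move=> g h gC hC gh1.
  have [i [mi sg _ _ _]] := gapP _ gC; have [j [mj _ sh _ _]] := gapP _ hC.
  have [->|nhg] := eqVneq h.1 g.2; first by right.
  case/or4P: (vertex_cmp inv nhg) => [->|/S_below/ltnW|hg|gh].
  + by left.
  + by right.
  + have /spineP[_ /(_ _ hg)] := sh; have /spineP[gi _] := sg.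
    by move: gi; rewrite mi; clear; lia.
  + right; apply/ltnW/S_request/orP; right; apply/existsP; exists g.1.
    have /andP[rg /eqP gm] := gC.
    by rewrite -surjective_pairing rg gh1 gh /= gm sh.
Qed.

(* Eight labels per level, of which six occur: two for the chords of a spine and
   two for the edges of each direction in the gap to its left. *)
Definition page_label e : 'I_(width G) * (bool * bool * bool) :=
  (Ordinal (level_width inv (if level e.1 <= level e.2 then e.2 else e.1)),
   if right_going e then (true, true, parity (right_class (level e.2)) e)
   else if left_going e then (true, false, parity (left_class (level e.1)) e)
   else (false, chord_right e, false)).

Lemma page_label_crossing e f : e \in edges G -> f \in edges G ->
  page_label e = page_label f ->
  S e.1 < S f.1 -> S f.1 < S e.2 -> S e.2 < S f.2 -> False.
Proof.
move=> eE fE [lE].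
have top g : level (if level g.1 <= level g.2 then g.2 else g.1) = chord_level g.
  by rewrite /chord_level; case: leqP.
rewrite !top in lE.
have rtop g : right_going g -> chord_level g = level g.2.
  by case/and3P=> _ /ltnW/maxn_idPr.
have ltop g : left_going g -> chord_level g = level g.1.
  by case/and3P=> _ /ltnW/maxn_idPl.
have [re|re] := boolP (right_going e); have [rf|rf] := boolP (right_going f).
- rewrite !rtop // in lE => -[pE] ef1 fe2 ef2.
  have := @right_crossing (level e.2) e f; rewrite /= re rf lE eqxx.
  by move=> /(_ isT isT ef1 fe2 ef2); rewrite -pE lE; case: parity.
- by case: ifP.
- by case: ifP.
have [le|le] := boolP (left_going e); have [lf|lf] := boolP (left_going f) => //.
- rewrite !ltop // in lE => -[pE] ef1 fe2 ef2.
  have := @left_crossing (level e.1) e f; rewrite /= le lf lE eqxx.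
  by move=> /(_ isT isT ef1 fe2 ef2); rewrite -pE lE; case: parity.
- by case=> cE; exact: chord_crossing.
Qed.

End Crossing.

(** The pages are the nonempty fibres of [c] on the edges, of which there are at most [#|T|]. *)
Lemma label_book_embedding (T : finType) (c : G * G -> T) (S : G -> nat) :
  injective S -> (forall e, e \in edges G -> S e.1 < S e.2) ->
  (forall e f, e \in edges G -> f \in edges G -> c e = c f ->
     S e.1 < S f.1 -> S f.1 < S e.2 -> S e.2 < S f.2 -> False) ->
  page_number G <= #|T|.
Proof.
move=> S_inj S_edge c_cross.
pose pages := finset.preim_partition c (edges G).
have le_pages : #|pages| <= #|T|.
  apply: leq_trans (leq_imset_card (fun t => [set e in edges G | t == c e]%SET) T).
  apply: subset_leq_card; apply/fintype.subsetP => B /finset.imsetP[e eE ->].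
  by apply/finset.imsetP; exists (c e).
apply: leq_trans le_pages; rewrite /page_number; case: ex_minnP => n _; apply.
apply/asboolP; exists (fun u v => S u < S v), pages; split=> //.
- split=> [u|v u w|u v uv|u v uv]; [by rewrite ltnn|exact: ltn_trans| |].
    by rewrite -neq_ltn; apply: contraNneq uv => /S_inj->.
  by apply: (S_edge (u, v)); rewrite inE.
- exact: finset.preim_partitionP.
move=> B /finset.imsetP[x _ ->] e f; rewrite !inE => /andP[eE /eqP xe] /andP[fE /eqP xf].
have ef : c e = c f by rewrite -xe.
apply/negP => /orP[] /and3P[]; apply: c_cross => //; by rewrite ?inE.
Qed.

Lemma page_number_width : page_number G <= 8 * width G.
Proof.
have [S [S_inj S_below S_request]] := linear_extension requests_consistent.
have -> : 8 * width G = #|{: 'I_(width G) * (bool * bool * bool)}|.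
  by rewrite !card_prod !card_bool card_ord mulnC.
apply: (label_book_embedding (c := page_label) S_inj).
  by move=> e eE; apply: S_below; exact: (edge_below inv).
exact: page_label_crossing.
Qed.

End Pages.

Theorem theorem2 (R : realType) (G : dag) (w : nat) :
  upward_planar R G -> width G = w -> (page_number G <= 14 * w)%N.
Proof.
case=> pos [curve drawing] <-; have [L [Rk inv]] := sweep_all drawing.
by apply: leq_trans (page_number_width inv) _; rewrite leq_mul2r orbT.
Qed.
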